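(* Let $G$ be a finite, undirected, simple, connected graph with $n$ vertices that is $k$-regular, where $k\geq 1$. If $k$ is odd, then $G$ is $\left(\frac{nk}{2}-1\right)$-approximately magic. If $k$ is even, then $G$ is $k$-approximately magic.
   Context: For a graph with $m$ edges, a labeling is a bijection $f$ from the edge set to $\{1,\ldots,m\}$; the vertex sum at a vertex $v$ is the sum of $f(e)$ over all edges $e$ incident with $v$. A labeling is $\delta$-approximately magic if the difference between the largest and the smallest vertex sums is at most $\delta$. A graph is $\delta$-approximately magic if it admits a $\delta$-approximately magic labeling. *)

(* Defs.v *)
From HB Require Import structures.
From mathcomp Require Import all_boot all_order all_algebra.

Set Implicit Arguments.
Unset Strict Implicit.
Unset Printing Implicit Defensive.

(* A finite simple graph is a symmetric irreflexive relation e on a finType;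
   the undirected edge between x and y is the two-element set [set x; y]. *)
Definition edges (T : finType) (e : rel T) : {set {set T}} :=
  [set [set p.1; p.2] | p : T * T & e p.1 p.2].

Definition connected_graph (T : finType) (e : rel T) : Prop :=
  0 < #|T| /\ forall x y : T, connect e x y.

Definition regular_graph (T : finType) (e : rel T) (k : nat) : Prop :=
  forall v : T, #|[set w | e v w]| = k.

(* The values of f outside edges e are irrelevant. *)
Definition labeling (T : finType) (e : rel T) (f : {set T} -> nat) : Prop :=
  [/\ {in edges e, forall a, 1 <= f a <= #|edges e|},
      {in edges e &, injective f}
    & forall i, 1 <= i <= #|edges e| -> exists2 a, a \in edges e & f a = i].

Definition vertex_sum (T : finType) (e : rel T) (f : {set T} -> nat) (v : T) :
  nat := \sum_(a in edges e | v \in a) f a.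

Definition largest_sum (T : finType) (e : rel T) (f : {set T} -> nat) : nat :=
  \max_(v : T) vertex_sum e f v.

(* minn has no neutral element; starting from the largest sum leaves the
   minimum over a nonempty T unchanged. *)
Definition smallest_sum (T : finType) (e : rel T) (f : {set T} -> nat) : nat :=
  \big[minn/largest_sum e f]_(v : T) vertex_sum e f v.

Definition approx_magic_labeling (T : finType) (e : rel T) (delta : rat)
  (f : {set T} -> nat) : Prop :=
  labeling e f /\
  ((largest_sum e f)%:R - (smallest_sum e f)%:R <= delta)%R.

Definition approx_magic (T : finType) (e : rel T) (delta : rat) : Prop :=
  exists f : {set T} -> nat, approx_magic_labeling e delta f.

(* Main.v *)
(* For even k, label the edges of an Euler circuit so that any two cyclically
   consecutive labels have sum in [m, m + 2]; each vertex collects k/2 such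
   sums.
   For odd k, add an apex joined to all vertices and take an Euler circuit of
   this cone.  Deleting the apex cuts it into trails such that every vertex is
   an end of exactly one trail.  Number the edges along the trails and give
   them the labels 1, m, 2, m - 1, ...: consecutive edges of a trail have sum
   m + 1 or m + 2, so each vertex collects (k - 1)/2 such sums and one label.
   Averaging, some trail has at least k edges; starting with it, every label
   at an end is at most m - (k - 1)/2, which absorbs the variation of the
   consecutive sums. *)
Require Import Defs.
From HB Require Import structures.
From mathcomp Require Import all_boot all_order all_algebra.
From mathcomp Require Import zify.

Set Implicit Arguments.
Unset Strict Implicit.

(** * Edges as two-element sets, and sums over the edges at a vertex *)

Lemma set2_inj (T : finType) (x y z w : T) :
  [set x; y] = [set z; w] -> (x = z /\ y = w) \/ (x = w /\ y = z).
Proof.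
move=> E.
have: x \in [set z; w] by rewrite -E set21.
have: y \in [set z; w] by rewrite -E set22.
have: z \in [set x; y] by rewrite E set21.
have: w \in [set x; y] by rewrite E set22.
by rewrite !inE; do 4 (case/orP=> /eqP ?); subst; auto.
Qed.

Lemma edgesP (T : finType) (e : rel T) (a : {set T}) :
  reflect (exists x y, e x y /\ a = [set x; y]) (a \in edges e).
Proof.
apply: (iffP imsetP) => [[[x y]]|[x [y [exy ->]]]].
  by rewrite inE /= => exy ->; exists x, y.
by exists (x, y) => //; rewrite inE.
Qed.

Lemma mem_edges (T : finType) (e : rel T) (x y : T) :
  symmetric e -> ([set x; y] \in edges e) = e x y.
Proof.
move=> e_sym; apply/edgesP/idP => [[u [w [euw]]]|exy]; last by exists x, y.
by case/set2_inj=> -[-> ->] //; rewrite e_sym.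
Qed.

(** Joining [v] to a neighbour is injective and hits exactly the edges at [v]. Taking [F] constantly
    1 recovers the degree. *)
Lemma sum_incident (T : finType) (e : rel T) (F : {set T} -> nat) (v : T) :
  symmetric e ->
  \sum_(a in edges e | v \in a) F a = \sum_(w | e v w) F [set v; w].
Proof.
move=> e_sym; pose h w : {set T} := [set v; w].
have inj_h : {in [set w | e v w] &, injective h}.
  by move=> w1 w2 _ _ /set2_inj [] [] // -> ->.
transitivity (\sum_(a in h @: [set w | e v w]) F a).
  apply: eq_bigl => a; apply/andP/imsetP => [[/edgesP[x [y [exy ->]]]]|[w]].
    rewrite !inE => /orP[] /eqP Ev; rewrite -{}Ev in exy *.
      by exists y; rewrite ?inE.
    by exists x; rewrite ?inE 1?e_sym // /h setUC.
  by rewrite inE => evw ->; rewrite mem_edges // set21.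
by rewrite big_imset //=; apply: eq_bigl => w; rewrite inE.
Qed.

Lemma card_incident (T : finType) (e : rel T) (v : T) : symmetric e ->
  #|[set a in edges e | v \in a]| = #|[set w | e v w]|.
Proof.
move=> e_sym; have := sum_incident (fun=> 1) v e_sym.
by rewrite !sum1dep_card.
Qed.

Lemma handshake (T : finType) (e : rel T) :
  symmetric e -> irreflexive e ->
  \sum_(v : T) #|[set w | e v w]| = #|edges e|.*2.
Proof.
move=> e_sym e_irr.
under eq_bigr => v _ do rewrite -card_incident // -sum1dep_card.
rewrite (exchange_big_dep (mem (edges e))) /=; last by move=> v a _ /andP[].
rewrite -muln2 -sum_nat_const; apply: eq_bigr => a a_e.
under eq_bigl => v do rewrite a_e /=.
case/edgesP: a_e => x [y [exy ->]]; rewrite sum1_card cards2.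
by case: eqP exy => // ->; rewrite e_irr.
Qed.

(** * Walks, trails and closed trails *)

Definition walk_edges (T : finType) (x : T) (p : seq T) : seq {set T} :=
  pairmap (fun u w => [set u; w]) x p.

Definition trail (T : finType) (e : rel T) (x : T) (p : seq T) : bool :=
  path e x p && uniq (walk_edges x p).

Lemma walk_edges_cat (T : finType) (x : T) (p q : seq T) :
  walk_edges x (p ++ q) = walk_edges x p ++ walk_edges (last x p) q.
Proof. exact: pairmap_cat. Qed.

Lemma path_edges (T : finType) (e : rel T) (x : T) (p : seq T) :
  path e x p -> {subset walk_edges x p <= edges e}.
Proof.
elim: p x => //= y p IHp x /andP[exy pth] a.
rewrite inE => /orP[/eqP ->|/(IHp _ pth)//].
by apply/edgesP; exists x, y.
Qed.

Lemma size_trail (T : finType) (e : rel T) (x : T) (p : seq T) :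
  trail e x p -> size p <= #|edges e|.
Proof.
case/andP=> /path_edges sub uniq_p.
rewrite -(size_pairmap (fun u w => [set u; w]) x p) -(card_uniqP uniq_p).
by apply/subset_leq_card/subsetP.
Qed.

(** Passing through [v] uses two edges at [v], so only the two ends of the walk affect the parity,
    and they cancel when the walk is closed. *)
Lemma trail_parity (T : finType) (e : rel T) (x v : T) (p : seq T) :
  irreflexive e -> path e x p ->
  odd (count (fun a : {set T} => v \in a) (walk_edges x p)) =
    (v == x) (+) (v == last x p).
Proof.
move=> e_irr; elim: p x => /= [|y p IHp] x; first by rewrite addbb.
case/andP=> exy /IHp; rewrite oddD => ->; rewrite !inE.
case: (eqVneq v x) => [->|_]; last by case: (v == y) => //; case: (_ == _).
by case: eqP exy => [<-|_ _]; rewrite ?e_irr //; case: (_ == _).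
Qed.

Lemma card_incident_trail (T : finType) (e : rel T) (x v : T) (p : seq T) :
  trail e x p ->
  #|[set a in edges e | v \in a] :&: [set a in walk_edges x p]| =
    count (fun a : {set T} => v \in a) (walk_edges x p).
Proof.
case/andP=> /path_edges sub uniq_p.
rewrite -size_filter -(card_uniqP (filter_uniq _ uniq_p)).
apply: eq_card => a; rewrite !inE mem_filter.
by case: (boolP (a \in walk_edges x p)) => [/sub -> //|]; rewrite ?andbT ?andbF.
Qed.

Lemma extend_trail_closed (T : finType) (e : rel T) (x : T) (p : seq T) :
  symmetric e -> irreflexive e ->
  (forall v, ~~ odd #|[set w | e v w]|) -> trail e x p ->
  exists q, trail e x (p ++ q) /\ last x (p ++ q) = x.
Proof.
move=> e_sym e_irr e_even.
have [n] := ubnP (#|edges e| - size p); elim: n p => // n IHn p le_n tr_p.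
have [/eqP last_x|ne_x] := boolP (last x p == x).
  by exists [::]; rewrite cats0.
set y := last x p in ne_x.
have [w /andP[eyw new_w]|all_old] :=
  pickP (fun w => e y w && ([set y; w] \notin walk_edges x p)).
  have tr_pw : trail e x (rcons p w).
    rewrite /trail rcons_path -cats1 walk_edges_cat /= cats1 rcons_uniq -/y.
    by rewrite eyw new_w andbT.
  have [|q] := IHn _ _ tr_pw; last by rewrite cat_rcons; exists (w :: q).
  by have := size_trail tr_pw; rewrite size_rcons; lia.
case/negP: (e_even y).
have := card_incident_trail y tr_p.
rewrite (setIidPl _) => [|].
  rewrite card_incident // => ->; case/andP: tr_p => pth _.
  by rewrite (trail_parity _ e_irr pth) -/y eqxx (negbTE ne_x).
apply/subsetP=> a; rewrite !inE => /andP[/edgesP[u [w [euw ->]]]].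
rewrite !inE => /orP[] /eqP Ey; first by have := all_old w; rewrite Ey euw => /negbFE.
by have := all_old u; rewrite Ey e_sym euw setUC => /negbFE.
Qed.

Lemma rotate_closed_trail (T : finType) (e : rel T) (x u : T) (p1 p2 : seq T) :
  u = last x p1 -> trail e x (p1 ++ p2) -> last x (p1 ++ p2) = x ->
  [/\ trail e u (p2 ++ p1), last u (p2 ++ p1) = u &
      perm_eq (walk_edges u (p2 ++ p1)) (walk_edges x (p1 ++ p2))].
Proof.
move=> Eu; rewrite /trail !last_cat -Eu !cat_path -Eu => tr_p last_x.
have Ew : perm_eq (walk_edges u (p2 ++ p1)) (walk_edges x (p1 ++ p2)).
  by rewrite !walk_edges_cat -Eu last_x perm_catC.
by rewrite (perm_uniq Ew) last_x -Eu andbC [X in _ && X]andbC andbC.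
Qed.

(** * Existence of Euler circuits *)

Definition euler_trail (T : finType) (e : rel T) (x : T) (p : seq T) : Prop :=
  [/\ trail e x p, last x p = x & {subset edges e <= walk_edges x p}].

Lemma euler_circuit (T : finType) (e : rel T) (x0 : T) :
  symmetric e -> irreflexive e ->
  (forall v, ~~ odd #|[set w | e v w]|) -> (forall u w, connect e u w) ->
  exists p, euler_trail e x0 p.
Proof.
move=> e_sym e_irr e_even e_conn.
(* Each splice moves the base point, so the circuit is only asked to pass through [x0] and is
   rotated back afterwards. *)
suff main n x p : #|edges e| - size p < n -> trail e x p -> last x p = x ->
    exists x p, [/\ trail e x p, last x p = x,
      x0 \in x :: p & {subset edges e <= walk_edges x p}].
  have [x [p [tr_p last_x x0p sub]]] := main _ x0 [::] (ltnSn _) isT erefl.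
  case/splitPl: x0p tr_p last_x sub => p1 p2 E tr_p last_x sub.
  have [tr_p' last_p' Ep] := rotate_closed_trail (esym E) tr_p last_x.
  by exists (p2 ++ p1); split=> // a /sub; rewrite (perm_mem Ep).
elim: n x p => // n IHn x p le_n tr_p last_x.
have [[u w] /and3P[/= up euw new_uw]|all_old] :=
  pickP (fun q => [&& q.1 \in x :: p, e q.1 q.2
                    & [set q.1; q.2] \notin walk_edges x p]); last first.
  have old u w : u \in x :: p -> e u w -> [set u; w] \in walk_edges x p.
    by move=> up euw; have := all_old (u, w); rewrite /= up euw /= => /negbFE.
  have cover a v : a \in walk_edges x p -> v \in a -> v \in x :: p.
    elim: (p) (x) => //= z q IHq y; rewrite inE => /orP[/eqP ->|az va].
      by rewrite !inE => /orP[] ->; rewrite ?orbT.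
    by rewrite inE IHq // orbT.
  (* Along a path from [x], every edge leaving a vertex of the trail is already used, so its other
     end is on the trail too. *)
  have all_in v : v \in x :: p.
    case/connectP: (e_conn x v) => q; elim/last_ind: q v => [|q z IHq] v /=.
      by move=> _ ->; rewrite mem_head.
    rewrite rcons_path last_rcons => /andP[pth eqz] ->.
    by apply: (cover _ _ (old _ _ (IHq _ pth erefl) eqz)); rewrite set22.
  exists x, p; split=> // a /edgesP[u [w [euw ->]]]; exact: old.
case/splitPl: up le_n tr_p last_x new_uw => p1 p2 E le_n tr_p last_x new_uw.
have [tr_u last_u Ep] := rotate_closed_trail (esym E) tr_p last_x.
rewrite size_cat addnC -size_cat in le_n.
rewrite -(perm_mem Ep) in new_uw.
move: (p2 ++ p1) => {p1 p2 E tr_p last_x Ep} p in tr_u last_u le_n new_uw *.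
pose e' := [rel a b | e a b && ([set a; b] \notin walk_edges u p)].
have e'_sym : symmetric e' by move=> a b /=; rewrite e_sym setUC.
have e'_irr : irreflexive e' by move=> a /=; rewrite e_irr.
have e'_edges : edges e' = edges e :\: [set a in walk_edges u p].
  apply/setP=> a; rewrite !inE.
  apply/edgesP/andP => [[y [z [/= /andP[eyz new] ->]]]|[new /edgesP[y [z]]]].
    by rewrite mem_edges.
  by case=> eyz Ea; exists y, z; rewrite /= eyz -Ea.
have e'_even v : ~~ odd #|[set z | e' v z]|.
  rewrite -(card_incident v e'_sym).
  have -> : [set a in edges e' | v \in a] =
      [set a in edges e | v \in a] :\: [set a in walk_edges u p].
    by apply/setP=> a; rewrite e'_edges !inE andbA.
  rewrite cardsD card_incident_trail // oddB; last first.
    by rewrite -(card_incident_trail v tr_u) subset_leq_card // subsetIl.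
  rewrite card_incident // (negbTE (e_even v)).
  by case/andP: tr_u => pth _; rewrite (trail_parity _ e_irr pth) last_u addbb.
have tr_w : trail e' u [:: w] by rewrite /trail /= euw new_uw.
have [q [tr_q last_q]] := extend_trail_closed e'_sym e'_irr e'_even tr_w.
have tr_pq : trail e u (p ++ ([:: w] ++ q)).
  case/andP: tr_u tr_q => pth_u uniq_u /andP[pth_q uniq_q].
  rewrite /trail cat_path walk_edges_cat cat_uniq last_u pth_u uniq_u uniq_q.
  have -> : path e u ([:: w] ++ q) by apply: sub_path pth_q => y z /andP[].
  rewrite !andbT; apply/hasPn => a /(path_edges pth_q).
  by rewrite e'_edges !inE => /andP[].
apply: (IHn _ _ _ tr_pq); last by rewrite last_cat last_u.
by have := size_trail tr_pq; rewrite !size_cat [size [:: w]]/=; lia.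
Qed.

(** * Vertex sums read along an Euler circuit *)

Lemma nth_walk_edges (T : finType) (x : T) (p : seq T) (i : nat) :
  i < size p ->
  nth set0 (walk_edges x p) i = [set nth x (x :: p) i; nth x p i].
Proof. by move=> lt_i; rewrite (nth_pairmap x). Qed.

Lemma size_walk_edges (T : finType) (x : T) (p : seq T) :
  size (walk_edges x p) = size p.
Proof. exact: size_pairmap. Qed.

(** Position [j] of [p] is the head of edge [j] and the tail of edge [j.+1]. On a nonempty closed
    walk the start [x] is recorded by the last position. *)
Definition visits (T : eqType) (x v : T) (p : seq T) : seq nat :=
  [seq j <- iota 0 (size p) | nth x p j == v].

Lemma mem_visits (T : eqType) (x v : T) (p : seq T) (j : nat) :
  (j \in visits x v p) = (j < size p) && (nth x p j == v).
Proof. by rewrite mem_filter mem_iota add0n andbC. Qed.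

Lemma size_visits (T : eqType) (x v : T) (p : seq T) :
  size (visits x v p) = count_mem v p.
Proof.
by rewrite size_filter -[in RHS](mkseq_nth x p) count_map.
Qed.

Lemma euler_perm (T : finType) (e : rel T) (x : T) (p : seq T) :
  euler_trail e x p -> perm_eq (enum (edges e)) (walk_edges x p).
Proof.
case=> /andP[/path_edges sub uniq_p] _ sup.
apply: uniq_perm => [|//|a]; first exact: enum_uniq.
by rewrite mem_enum; apply/idP/idP => [/sup|/sub].
Qed.

(* Each visit of v uses the edge arriving at v and the next one. *)
Lemma euler_sum (T : finType) (e : rel T) (x : T) (p : seq T)
  (F : {set T} -> nat) (v : T) :
  irreflexive e -> euler_trail e x p ->
  \sum_(a in edges e | v \in a) F a =
    \sum_(j <- visits x v p)
      (F (nth set0 (walk_edges x p) j) +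
       F (nth set0 (walk_edges x p) (j.+1 %% size p))).
Proof.
move=> e_irr eul; have [/andP[pth _] last_x _] := eul.
rewrite -big_enum_cond (perm_big _ (euler_perm eul)) /=.
rewrite (big_nth set0) size_walk_edges /visits big_filter.
rewrite -[iota 0 _]/(iota 0 (size p)) -{2}[size p]subn0 -/(index_iota 0 _).
set E := nth set0 (walk_edges x p); set M := size p.
have c_irr i : i < M -> nth x (x :: p) i != nth x p i.
  move=> lt_i; have := pathP x pth i lt_i.
  by case: eqP => // ->; rewrite e_irr.
(* Each edge at [v] has [v] as its head or as its tail, never as both, since there are no loops. *)
transitivity (\sum_(0 <= i < M | nth x p i == v) F (E i) +
              \sum_(0 <= i < M | nth x (x :: p) i == v) F (E i)).
  rewrite !(big_mkcond (fun i => _ == v)) -big_split big_mkcond /=.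
  apply: eq_big_nat => i /andP[_ lt_i].
  rewrite {1}/E nth_walk_edges // !inE ![v == _]eq_sym.
  have := c_irr i lt_i; case: (nth x (x :: p) i =P v) => [->|_ _] /=.
    by rewrite eq_sym => /negbTE ->.
  by rewrite addn0.
rewrite big_split; congr (_ + _) => /=.
case: (posnP M) => [->|M_gt0]; first by rewrite !big_geq.
rewrite -(prednK M_gt0) !(big_mkcond (fun i => _ == v)) /=.
(* Shifting tails by one turns them into heads of the previous edge. Edge 0 wraps around to the last
   position, where the closed walk returns to [x]. *)
rewrite big_nat_recl // big_nat_recr //= addnC (prednK M_gt0) modnn.
congr (_ + _); last by rewrite /M nth_last last_x.
apply: eq_big_nat => i /andP[_ lt_i].
by rewrite modn_small // -(prednK M_gt0) ltnS.
Qed.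

(** This is [euler_sum] with constant weight 1: two edges per visit. *)
Lemma euler_degree (T : finType) (e : rel T) (x : T) (p : seq T) (v : T) :
  symmetric e -> irreflexive e -> euler_trail e x p ->
  (count_mem v p).*2 = #|[set w | e v w]|.
Proof.
move=> e_sym e_irr eul.
rewrite -card_incident // -sum1dep_card (euler_sum _ _ e_irr eul).
by rewrite big_const_seq count_predT iter_addn_0 size_visits mul2n.
Qed.

(** * From bounds on vertex sums to approximate magic *)

Lemma sum_bounds (I : eqType) (s : seq I) (h : I -> nat) (lo hi : nat) :
  {in s, forall j, lo <= h j <= hi} ->
  size s * lo <= \sum_(j <- s) h j <= size s * hi.
Proof.
elim: s => [|j s IHs] h_s; first by rewrite big_nil.
rewrite big_cons /= !mulSn.
have /andP[??] : size s * lo <= \sum_(i <- s) h i <= size s * hi.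
  by apply: IHs => i i_s; apply: h_s; rewrite inE i_s orbT.
by have /andP[??] := h_s j (mem_head _ _); rewrite !leq_add.
Qed.

(** Surjectivity comes from counting: the values are as many distinct numbers as the range
    contains. *)
Lemma injective_labeling (T : finType) (e : rel T) (f : {set T} -> nat) :
  {in edges e, forall a, 1 <= f a <= #|edges e|} ->
  {in edges e &, injective f} -> labeling e f.
Proof.
move=> f_range f_inj; split=> // i i_range.
have uniq_f : uniq (map f (enum (edges e))).
  rewrite map_inj_in_uniq ?enum_uniq // => a b.
  by rewrite !mem_enum; apply: f_inj.
have sub_f : {subset map f (enum (edges e)) <= iota 1 #|edges e|}.
  move=> j /mapP[a]; rewrite mem_enum => /f_range; rewrite mem_iota => ? ->.
  by rewrite add1n ltnS.
have [] := uniq_min_size uniq_f sub_f; first by rewrite size_map -cardE size_iota.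
move=> _ /(_ i); rewrite mem_iota add1n ltnS i_range => /mapP[a].
by rewrite mem_enum => ? ->; exists a.
Qed.

Lemma approx_magic_of_bounds (T : finType) (e : rel T) (f : {set T} -> nat)
  (lo d : nat) :
  0 < #|T| -> labeling e f ->
  (forall v, lo <= vertex_sum e f v <= lo + d) ->
  approx_magic e (d%:R)%R.
Proof.
move=> /card_gt0P[v0 _] lab_f f_bnd; exists f; split=> //.
rewrite Num.Theory.lerBlDr -GRing.natrD Num.Theory.ler_nat.
have le_max : largest_sum e f <= lo + d.
  by apply/bigmax_leqP => v _; case/andP: (f_bnd v).
have ge_min : lo <= smallest_sum e f.
  apply: (big_ind (fun y => lo <= y)) => [|y z ??|v _].
  (* The minimum starts from the largest sum, so [lo] has to bound that as well; the vertex [v0]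
     provides this. *)
  - apply: (leq_trans _ (leq_bigmax v0)).
    by case/andP: (f_bnd v0).
  - by rewrite leq_min; apply/andP.
  - by case/andP: (f_bnd v).
by rewrite addnC (leq_trans le_max) // leq_add2r.
Qed.

(** * Even degree: cyclic labels on an Euler circuit *)

(* For even m, cyclically consecutive labels can only have nearly constant
   sums if the two interleaved sequences turn back halfway. *)
Definition cyclic_label (m i : nat) : nat :=
  if odd i == (~~ odd m && (m./2 <= i)) then i.+1 else m - i.

Lemma cyclic_label_range (m i : nat) : i < m -> 1 <= cyclic_label m i <= m.
Proof. by rewrite /cyclic_label; case: ifP => _; lia. Qed.

(** A collision between the two branches forces [i + j = m.-1]. For odd [m] the indices then have
    equal parity; for even [m] they have opposite parity and lie in opposite halves. Either way they
    belong to the same branch. *)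
Lemma cyclic_label_inj (m i j : nat) : i < m -> j < m ->
  cyclic_label m i = cyclic_label m j -> i = j.
Proof.
rewrite /cyclic_label; case: ifP => /eqP Hi; case: ifP => /eqP Hj; lia.
Qed.

(** The sums are [m] or [m.+2], except for [m.+1] at the wrap-around and, for even [m], at the
    halfway turn. *)
Lemma cyclic_label_sum (m i : nat) : i < m ->
  m <= cyclic_label m i + cyclic_label m (i.+1 %% m) <= m.+2.
Proof.
move=> lt_i; have [lt_i1|] := ltnP i.+1 m.
  rewrite modn_small // /cyclic_label.
  case: ifP => /eqP Hi; case: ifP => /eqP Hj; lia.
move=> ge_m; have -> : i.+1 = m by lia.
rewrite modnn /cyclic_label; case: ifP => /eqP Hi; case: ifP => /eqP Hj; lia.
Qed.

Lemma euler_size (T : finType) (e : rel T) (x : T) (p : seq T) :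
  euler_trail e x p -> size p = #|edges e|.
Proof.
by move/euler_perm/perm_size; rewrite size_walk_edges -cardE.
Qed.

Lemma approx_magic_even (T : finType) (e : rel T) (k : nat) :
  symmetric e -> irreflexive e -> connected_graph e -> regular_graph e k ->
  ~~ odd k -> approx_magic e (k%:R)%R.
Proof.
move=> e_sym e_irr [T_gt0 e_conn] e_reg k_even.
have /card_gt0P[x _] := T_gt0.
have [|p eul] := euler_circuit x e_sym e_irr _ e_conn.
  by move=> v; rewrite e_reg.
have [/andP[_ uniq_p] _ sup] := eul.
set W := walk_edges x p in uniq_p sup.
set m := #|edges e|; have size_p : size p = m := euler_size eul.
have size_W : size W = m by rewrite size_walk_edges.
pose f a := cyclic_label m (index a W).
have index_lt a : a \in edges e -> index a W < m.
  by move/sup; rewrite -size_W index_mem.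
have f_nth j : j < m -> f (nth set0 W j) = cyclic_label m j.
  by move=> lt_j; rewrite /f index_uniq ?size_W.
apply: (@approx_magic_of_bounds _ _ f (k./2 * m)) => //.
  apply: injective_labeling => [a|a b] a_e; first exact/cyclic_label_range/index_lt.
  move=> b_e /cyclic_label_inj -/(_ (index_lt _ a_e) (index_lt _ b_e)) E.
  by rewrite -[a](nth_index set0 (sup _ a_e)) -/W E nth_index ?sup.
move=> v; rewrite /vertex_sum (euler_sum _ _ e_irr eul) -/W.
have size_v : size (visits x v p) = k./2.
  by rewrite size_visits -(e_reg v) -(euler_degree v e_sym e_irr eul) doubleK.
have -> : k./2 * m + k = k./2 * m.+2 by lia.
rewrite -size_v; apply: sum_bounds => j.
rewrite mem_visits size_p => /andP[lt_j _].
have m_gt0 : 0 < m by lia.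
by rewrite !f_nth ?ltn_mod // cyclic_label_sum.
Qed.

(** * Odd degree: the cone and a circuit with a long first trail *)

(** Pigeonhole: as [p] ends in [x], the occurrences of [x] cut it into [count_mem x p] blocks, which
    hold more than [k] entries on average. A long block is truncated to [k.+1] vertices, that is,
    [k] edges. *)
Lemma long_block (T : eqType) (x : T) (k : nat) (p : seq T) :
  last x p = x -> k * count_mem x p < size p - count_mem x p ->
  exists p1 b p2,
    [/\ p = p1 ++ b ++ p2, last x p1 = x, x \notin b & size b = k.+1].
Proof.
have [n] := ubnP (size p); elim: n p => // n IHn p le_n last_p.
have [xp|] := boolP (x \in p); last first.
  by case: p last_p {le_n} => //= y p <-; rewrite mem_last.
set b := take (index x p) p; set q := drop (index x p).+1 p.
have Ep : p = b ++ x :: q.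
  rewrite -{1}(cat_take_drop (index x p) p) (drop_nth x) ?index_mem //.
  by rewrite nth_index.
have xb : x \notin b by rewrite in_take // ltnn.
move: b q Ep xb {xp} => b q Ep xb; subst p.
rewrite last_cat /= in last_p.
rewrite size_cat count_cat /= eqxx (count_memPn xb) => gt_k.
have [lt_kb|le_bk] := ltnP k (size b).
  exists [::], (take k.+1 b), (drop k.+1 b ++ x :: q).
  rewrite size_takel //; split=> //; first by rewrite /= catA cat_take_drop.
  by apply: contra xb; apply: mem_take.
have [||p1 [b' [p2 [-> last_p1 xb' size_b']]]] := IHn q _ last_p.
- by rewrite size_cat /= in le_n; lia.
- by have := count_size (pred1 x) q; nia.
by exists (b ++ x :: p1), b', p2; rewrite -catA last_cat.
Qed.

(* The apex is None. *)
Definition cone (T : finType) (e : rel T) : rel (option T) :=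
  fun a b => match a, b with
  | Some x, Some y => e x y
  | None, None => false
  | _, _ => true
  end.

Lemma cone_sym (T : finType) (e : rel T) : symmetric e -> symmetric (cone e).
Proof. by move=> e_sym [x|] [y|] /=. Qed.

Lemma cone_irr (T : finType) (e : rel T) :
  irreflexive e -> irreflexive (cone e).
Proof. by move=> e_irr [x|] /=. Qed.

Lemma cone_connect (T : finType) (e : rel T) (a b : option T) :
  symmetric e -> connect (cone e) a b.
Proof.
move=> e_sym; have c_apex y : connect (cone e) None y.
  by case: y => [y|]; [apply: connect1 | apply: connect0].
apply: connect_trans (c_apex b).
by rewrite (sym_connect_sym (cone_sym e_sym)).
Qed.

Lemma sum_cone_neighbours (T : finType) (e : rel T) (v : T)
  (G : option T -> nat) :
  \sum_(w | cone e (Some v) w) G w = G None + \sum_(w | e v w) G (Some w).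
Proof.
rewrite (bigD1 None) //=; congr (_ + _).
rewrite (reindex_omap Some id) => [|[w|]] //=.
by apply: eq_bigl => w; rewrite eqxx !andbT.
Qed.

Lemma cone_degree (T : finType) (e : rel T) (v : T) :
  #|[set w | cone e (Some v) w]| = #|[set w | e v w]|.+1.
Proof. by rewrite -!sum1dep_card sum_cone_neighbours. Qed.

Lemma cone_degree_apex (T : finType) (e : rel T) :
  #|[set w | cone e None w]| = #|T|.
Proof.
rewrite -[RHS]cardsT -(card_imset [set: T] Some_inj); apply: eq_card => -[w|].
  by rewrite inE; apply/esym/imsetP; exists w.
by rewrite inE /=; apply/esym/imsetP => -[].
Qed.

(** * Odd degree: zigzag labels along the trails *)

Definition path_label (m r : nat) : nat :=
  if odd r then r./2.+1 else m.+1 - r./2.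

Lemma path_label_range (m r : nat) : 1 <= r <= m -> 1 <= path_label m r <= m.
Proof. by rewrite /path_label; case: ifP => ?; lia. Qed.

Lemma path_label_inj (m r s : nat) : 1 <= r <= m -> 1 <= s <= m ->
  path_label m r = path_label m s -> r = s.
Proof. by rewrite /path_label; case: ifP => ?; case: ifP => ?; lia. Qed.

Lemma path_label_sum (m r : nat) : 1 <= r -> r < m ->
  m.+1 <= path_label m r + path_label m r.+1 <= m.+2.
Proof. by rewrite /path_label /= uphalf_half; case Er: (odd r) => /=; lia. Qed.

(** Odd positions carry labels at most half of [m.+1], small enough since [k <= m]. Large labels sit
    at even positions, and an even [r >= k] is at least [k.+1] because [k] is odd. *)
Lemma path_label_end (m k r : nat) : odd k -> k <= m -> 1 <= r <= m ->
  (r == 1) || (k <= r) -> 1 <= path_label m r <= m - k./2.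
Proof. by rewrite /path_label; case: ifP => ?; lia. Qed.

Lemma regular_handshake (T : finType) (e : rel T) (k : nat) :
  symmetric e -> irreflexive e -> regular_graph e k ->
  #|T| * k = #|edges e|.*2.
Proof.
move=> e_sym e_irr e_reg; rewrite -handshake //.
by under eq_bigr do rewrite e_reg; rewrite sum_nat_const.
Qed.

Lemma card_edges_cone (T : finType) (e : rel T) (k : nat) :
  symmetric e -> irreflexive e -> regular_graph e k ->
  #|edges (cone e)|.*2 = #|T| + #|T| * k.+1.
Proof.
move=> e_sym e_irr e_reg.
rewrite -(handshake (cone_sym e_sym) (cone_irr e_irr)) (bigD1 None) //=.
rewrite (cone_degree_apex e); congr (_ + _).
rewrite (reindex_omap Some id) => [|[w|]] //=.
under eq_bigr => w _ do rewrite (cone_degree e w) e_reg.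
by rewrite -sum_nat_const; apply: eq_bigl => w; rewrite eqxx.
Qed.

(** Cone degrees are even: [k.+1] off the apex and [#|T|] at it, the latter by the handshake
    identity. The circuit meets the apex [#|T|./2] times and the other vertices [k.+1] times as
    often, so [long_block] applies; rotation puts the long block first. *)
Lemma euler_cone (T : finType) (e : rel T) (k : nat) :
  symmetric e -> irreflexive e -> 0 < #|T| -> regular_graph e k -> odd k ->
  exists b q, [/\ euler_trail (cone e) None (b ++ q),
    None \notin b & size b = k.+1].
Proof.
move=> e_sym e_irr T_gt0 e_reg k_odd.
have c_sym := cone_sym e_sym; have c_irr := cone_irr e_irr.
have hs := regular_handshake e_sym e_irr e_reg.
have deg_some v : #|[set w | cone e (Some v) w]| = k.+1.
  by rewrite cone_degree e_reg.
have [v|a b|p eul] := euler_circuit None c_sym c_irr.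
- case: v => [v|]; first by rewrite deg_some /= negbK.
  rewrite cone_degree_apex; have : ~~ odd (#|T| * k) by rewrite hs odd_double.
  by rewrite oddM k_odd andbT.
- exact: cone_connect.
have count_apex := euler_degree None c_sym c_irr eul.
rewrite (cone_degree_apex e) in count_apex.
have size_p : (size p).*2 = #|T| + #|T| * k.+1.
  by rewrite (euler_size eul) (card_edges_cone e_sym e_irr e_reg).
have [tr_p last_p sup] := eul.
have gt_k : k * count_mem None p < size p - count_mem None p.
  move: size_p T_gt0; rewrite -count_apex -doubleMl -doubleD double_gt0.
  by move=> /double_inj -> c_gt0; rewrite addKn mulnC ltn_pmul2l.
have [p1 [b [p2 [Ep last_p1 xb size_b]]]] := long_block last_p gt_k.
subst p; have [tr_q last_q Eq] := rotate_closed_trail (esym last_p1) tr_p last_p.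
rewrite -catA in tr_q last_q Eq.
by exists b, (p2 ++ p1); split=> //; split=> // a /sup; rewrite (perm_mem Eq).
Qed.

(** * Odd degree: the labeling and the bounds on its sums *)

Lemma approx_magic_odd (T : finType) (e : rel T) (k : nat) :
  symmetric e -> irreflexive e -> 0 < #|T| -> regular_graph e k -> odd k ->
  approx_magic e (#|edges e|.-1%:R)%R.
Proof.
move=> e_sym e_irr T_gt0 e_reg k_odd.
have c_sym := cone_sym e_sym; have c_irr := cone_irr e_irr.
have [b [q [eul b_real size_b]]] := euler_cone e_sym e_irr T_gt0 e_reg k_odd.
set p := b ++ q in eul.
have p_real j : j <= k -> nth None p j != None.
  rewrite -ltnS -size_b => lt_j; rewrite nth_cat lt_j.
  by apply: contraNneq b_real => <-; apply: mem_nth.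
have [/andP[pth_p uniq_p] last_p sup] := eul.
set W := walk_edges None p in uniq_p sup.
set m := #|edges e|; set M := size p.
have size_W : size W = M by rewrite size_walk_edges.
have size_M : k < M by rewrite /M size_cat size_b; lia.
pose c i := nth None (None :: p) i.
pose E i := nth set0 W i.
have E_c i : i < M -> E i = [set c i; c i.+1] by apply: nth_walk_edges.
have E_inj i j : i < M -> j < M -> E i = E j -> i = j.
  by move=> ? ? /eqP; rewrite nth_uniq ?size_W // => /eqP.
pose real (a : {set option T}) := None \notin a.
have real_E i : i < M -> real (E i) = (c i != None) && (c i.+1 != None).
  by move=> lt_i; rewrite /real E_c // !inE negb_or ![None == _]eq_sym.
(* The number of edges of the graph itself among the first i of the circuit. *)
pose rk i := count real (take i W).
have rkS i : i < M -> rk i.+1 = rk i + real (E i).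
  move=> lt_i; rewrite /rk (take_nth set0) ?size_W // -cats1 count_cat /=.
  by rewrite addn0.
have rk_le i j : i <= j -> rk i <= rk j.
  move=> le_ij; rewrite /rk -(take_takel W le_ij).
  exact/leq_count_subseq/take_subseq.
have rk_M : rk M = m.
  rewrite /rk -size_W take_size.
  have := count_predC real W; rewrite size_W /M (euler_size eul).
  have -> : count (predC real) W = #|T|.
    rewrite -(cone_degree_apex e) -(card_incident _ c_sym) -sum1dep_card.
    rewrite -big_enum_cond (perm_big _ (euler_perm eul)) sum1_count.
    by apply: eq_count => a; rewrite /= negbK.
  have := card_edges_cone e_sym e_irr e_reg; rewrite mulnS.
  by rewrite (regular_handshake e_sym e_irr e_reg) -/m; lia.
have rk_lt i : i < M -> real (E i) -> rk i < m.
  by move=> lt_i real_i; have := rk_le _ _ lt_i; rewrite rkS // real_i rk_M addn1.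
have rk_inj i j : i < M -> j < M -> real (E i) -> real (E j) ->
    rk i = rk j -> i = j.
  have lt_rk i' j' : i' < j' -> i' < M -> real (E i') -> rk i' < rk j'.
    by move=> /rk_le le lt_i real_i; move: le; rewrite rkS // real_i addn1.
  move=> lt_i lt_j real_i real_j Eij.
  case: (ltngtP i j) => // lt_ij.
    by have := lt_rk _ _ lt_ij lt_i real_i; rewrite Eij ltnn.
  by have := lt_rk _ _ lt_ij lt_j real_j; rewrite Eij ltnn.
have M_gt0 : 0 < M by apply: leq_ltn_trans size_M.
(* Edge 0 leaves the apex and edges 1 to [k] lie inside the long block, so ranks there are
   explicit. *)
have rk_first : rk 1 = 0 by rewrite rkS // real_E // /rk take0.
have rk_block i : i <= k -> rk i.+1 = i.
  elim: i => // i IHi lt_i; rewrite rkS ?(leq_trans _ size_M) // IHi ?(ltnW lt_i) //.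
  by rewrite real_E ?(leq_trans _ size_M) // /c /= !p_real ?(ltnW lt_i) ?addn1.
have k_le_m : k <= m by rewrite -rk_M -(rk_block k) // rk_le.
(* Positions in [path_label] start at 1, whence the [.+1]. Apex edges weigh 0, so sums at real
   vertices are the same in the cone and in the graph. *)
pose F a := if real a then path_label m (rk (index a W)).+1 else 0.
have F_E i : i < M ->
    F (E i) = if real (E i) then path_label m (rk i).+1 else 0.
  by move=> lt_i; rewrite /F index_uniq ?size_W.
have lift_edge a : a \in edges e ->
    exists i, [/\ i < M, E i = [set Some x | x in a] & real (E i)].
  case/edgesP=> x [y [exy ->]].
  have -> : [set Some z | z in [set x; y]] = [set Some x; Some y].
    by rewrite imsetU1 imset_set1.
  have inW : [set Some x; Some y] \in W by rewrite sup // mem_edges.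
  exists (index [set Some x; Some y] W).
  by rewrite -size_W index_mem /E nth_index // /real !inE.
pose f (a : {set T}) := F [set Some x | x in a].
have lab_f : labeling e f.
  apply: injective_labeling => [a|a1 a2].
    case/lift_edge=> i [lt_i Ei real_i]; rewrite /f -Ei F_E // real_i.
    by rewrite path_label_range //= rk_lt.
  case/lift_edge=> i [lt_i Ei real_i] /lift_edge[j [lt_j Ej real_j]].
  rewrite /f -Ei -Ej !F_E // real_i real_j.
  move/path_label_inj => /(_ (rk_lt i lt_i real_i) (rk_lt j lt_j real_j)).
  case=> /(rk_inj _ _ lt_i lt_j real_i real_j) Eij.
  by apply: (imset_inj Some_inj); rewrite -Ei -Ej Eij.
(* The lower bound is [k./2] pairs of at least [m.+1] plus one label of at least 1. The upper bound
   [k./2 * m.+2 + (m - k./2)] exceeds it by exactly [m.-1]. *)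
apply: (@approx_magic_of_bounds _ _ f (k./2 * m.+1 + 1)) => // v.
have -> : vertex_sum e f v = \sum_(a in edges (cone e) | Some v \in a) F a.
  rewrite /vertex_sum !sum_incident // sum_cone_neighbours.
  rewrite {1}/F /real !inE orbT add0n; apply: eq_bigr => w _.
  by rewrite /f imsetU1 imset_set1.
rewrite (euler_sum _ _ c_irr eul) -/W -/M.
set V := visits None (Some v) p; set h := BIG_F.
(* The circuit ends at the apex, so a visit of [v] is never the last position and no wrap-around
   occurs. *)
have V_bound j : j \in V -> [/\ j.+1 < M, c j.+1 = Some v & c j.+1 != None].
  rewrite mem_visits => /andP[lt_j /eqP cj]; split; rewrite /c /= ?cj //.
  rewrite ltn_neqAle lt_j andbT; apply: contra_eq_neq cj => Ej.
  by rewrite -[j]/(j.+1.-1) Ej nth_last last_p.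
have h_E j : j \in V -> h j = F (E j) + F (E j.+1).
  by case/V_bound=> lt_j _ _; rewrite /h modn_small.
have [i0 [lt_i0 E_i0]] : exists i, i < M /\ E i = [set Some v; None].
  have inW : [set Some v; None] \in W by rewrite sup // mem_edges.
  by exists (index [set Some v; None] W); rewrite -size_W index_mem /E nth_index.
have i0_uniq j i : j \in V -> (i == j) || (i == j.+1) -> ~~ real (E i) -> i = i0.
  case/V_bound=> lt_j cj _ ij; have lt_i : i < M by case/orP: ij => /eqP ->; lia.
  rewrite real_E // negb_and !negbK => c_none; apply: E_inj => //.
  rewrite E_i0 E_c //; case/orP: ij c_none => /eqP -> /=; rewrite cj ?orbF /=.
    by move=> /eqP ->; rewrite setUC.
  by move=> /eqP ->.
(* Apart from edge 0, every apex edge comes after the long block, hence after at least [k] real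
   edges. *)
have rk_end i : i < M -> ~~ real (E i) -> i = 0 \/ k <= rk i.
  case: i => [|i] lt_i nreal; [by left | right].
  have [le_ik|lt_ki] := leqP i k; last by rewrite -(rk_block k) // rk_le // ltnW.
  move: nreal; rewrite real_E // negb_and !negbK /c /=.
  rewrite (negbTE (p_real _ le_ik)) /= => /eqP p_none.
  rewrite rk_block // leqNgt; apply/negP => /p_real.
  by rewrite p_none.
(* [j0] is the one visit that uses the apex edge at [v]; its other edge is the end edge of a
   trail. *)
have [j0 [j0_V j0_only j0_end]] : exists j0, [/\ j0 \in V,
    forall j, j \in V -> (i0 == j) || (i0 == j.+1) -> j = j0
    & 1 <= h j0 <= m - k./2].
  have nreal_i0 : ~~ real (E i0) by rewrite E_i0 /real negbK set22.
  have [] : [set c i0; c i0.+1] = [set Some v; None] by rewrite -E_c.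
  have rk_i0 : rk i0.+1 = rk i0 by rewrite rkS // (negbTE nreal_i0) addn0.
  (* Either a trail stops at [v], and its last edge has position [rk i0 >= k], or a trail starts at
     [v], and its first edge has position [(rk i0).+1], which is 1 or exceeds [k]. *)
  case/set2_inj => -[c_i0 c_i0S].
    case: i0 => [|j0] // in lt_i0 E_i0 i0_uniq nreal_i0 c_i0 c_i0S rk_i0 *.
    have j0_V : j0 \in V by rewrite mem_visits (ltnW lt_i0); apply/eqP.
    exists j0; split=> // [j /V_bound[_ c_j _]|].
      by case/orP=> /eqP // Ej; [rewrite -Ej c_i0S in c_j | case: Ej].
    have real_j0 : real (E j0).
      apply: contraT => /(i0_uniq _ _ j0_V); rewrite eqxx => /(_ isT); lia.
    rewrite h_E // !F_E ?(ltnW lt_i0) // real_j0 (negbTE nreal_i0) addn0.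
    apply: path_label_end => //; first by rewrite rk_lt // ltnW.
    have [//|] := rk_end _ lt_i0 nreal_i0.
    by rewrite rkS ?(ltnW lt_i0) // real_j0 addn1 => ->; rewrite orbT.
  have i0_V : i0 \in V by rewrite mem_visits lt_i0; apply/eqP.
  exists i0; split=> // [j /V_bound[_ c_j _]|].
    by case/orP=> /eqP // Ej; rewrite -Ej c_i0 in c_j.
  have [lt_i0S _ _] := V_bound _ i0_V.
  have real_i0S : real (E i0.+1).
    apply: contraT => /(i0_uniq _ _ i0_V); rewrite eqxx orbT => /(_ isT); lia.
  rewrite h_E // !F_E // real_i0S (negbTE nreal_i0) add0n.
  apply: path_label_end => //; first by rewrite rk_lt.
  rewrite rk_i0; have [->|le_k] := rk_end _ lt_i0 nreal_i0.
    by rewrite /rk take0.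
  by rewrite (leq_trans le_k) ?orbT.
(* At the other visits both edges are real, so their ranks are consecutive. *)
have V_inner j : j \in rem j0 V -> m.+1 <= h j <= m.+2.
  rewrite mem_rem_uniq ?filter_uniq ?iota_uniq // inE => /andP[ne_j j_V].
  have real_j i : (i == j) || (i == j.+1) -> real (E i).
    move=> ij; apply: contraNT ne_j => nreal_i; apply/eqP/j0_only => //.
    by rewrite -(i0_uniq _ _ j_V ij nreal_i).
  have [lt_j _ _] := V_bound _ j_V.
  have real_1 : real (E j) by rewrite real_j ?eqxx.
  have real_2 : real (E j.+1) by rewrite real_j ?eqxx ?orbT.
  rewrite h_E // !F_E ?(ltnW lt_j) // real_1 real_2.
  have rk_j : rk j.+1 = (rk j).+1 by rewrite rkS ?(ltnW lt_j) // real_1 addn1.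
  by rewrite rk_j path_label_sum // -rk_j rk_lt.
have size_V : size (rem j0 V) = k./2.
  rewrite size_rem // size_visits.
  have := euler_degree (Some v) c_sym c_irr eul.
  rewrite cone_degree e_reg => /(congr1 half); rewrite doubleK => ->.
  by rewrite /= uphalf_half k_odd.
have := sum_bounds V_inner; rewrite size_V (perm_big _ (perm_to_rem j0_V)).
rewrite big_cons /= !mulnS; lia.
Qed.

Theorem theorem1p1 (T : finType) (e : rel T) (n k : nat)
  (e_sym : symmetric e) (e_irr : irreflexive e)
  (e_conn : connected_graph e) (card_T : #|T| = n)
  (k_ge1 : 1 <= k) (e_reg : regular_graph e k) :
  (odd k -> approx_magic e (n%:R * k%:R / 2%:R - 1)%R) /\
  (~~ odd k -> approx_magic e (k%:R)%R).
Proof.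
split=> k_odd; last exact: approx_magic_even.
have [T_gt0 _] := e_conn.
have hs := regular_handshake e_sym e_irr e_reg.
have m_gt0 : 0 < #|edges e| by rewrite -double_gt0 -hs muln_gt0 T_gt0.
have -> : (n%:R * k%:R / 2%:R - 1 = #|edges e|.-1%:R :> rat)%R.
  rewrite -GRing.natrM -card_T hs -muln2 GRing.natrM GRing.mulfK //.
  by rewrite -[in LHS](prednK m_gt0) -GRing.natr1 GRing.addrK.
exact: approx_magic_odd.
Qed.
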